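(* The monoid $F[T]$ defined in the context is not Markov.
   Context: A finite alphabet $A$ represents a generating set for a monoid $M$ if there is a map $\phi : A \to M$ extending to a surjective homomorphism $A^* \to M$; the word $w$ represents the element $w\phi$. A language $L \subseteq A^*$ is prefix-closed if for all $u \in A^*$, $v \in A^+$, $uv \in L$ implies $u \in L$. A monoid $M$ is Markov if there exist a finite alphabet $A$ representing a generating set for $M$ and a regular prefix-closed language $L \subseteq A^*$ such that every element of $M$ is represented by exactly one word in $L$. Construction $S[T]$: given a (right) action of a semigroup $S$ on a set $T$ (disjoint from $S$), $S[T]$ is the semigroup with carrier set $S \cup T$ in which multiplication in $S$ is unchanged and, for $s \in S$ and $x, y \in T$, $sx = x$, $xs = x \cdot s$, $xy = y$. The specific monoid $F[T]$: here $\mathbb{N} = \{1,2,3,\ldots\}$. Let $F$ and $F'$ be free monoids with bases $X = \{x,y\}$ and $X' = \{x',y'\}$ respectively. Let $R = \{w \in F' : |w|_{y'} \text{ is even}\}$, where $|w|_{y'}$ is the number of occurrences of $y'$ in $w$. Let $w_0, w_1, w_2, \ldots$ be the elements of $R$ enumerated in length-plus-lexicographic order (shorter words first; words of equal length ordered lexicographically with respect to a fixed ordering of $X'$), and define the bijection $\psi : \mathbb{N}\cup\{0\} \to R$ by $j\psi = w_j$. Let $P = \{p_i : i \in \mathbb{N}\}$, $Q = \{q_i : i \in \mathbb{N},\ i \text{ is not of the form } 2^j \text{ with } j \in \mathbb{N}\cup\{0\}\}$, and $T = P \cup Q \cup F' \cup \{\Omega\}$ (a disjoint union, with distinct $p_i$'s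 and distinct $q_i$'s). Let $F$ act on the right on $T$ via the unique action extending the following action of the generators $x,y$: $p_i \cdot x = p_{i+1}$; $p_i \cdot y = q_i$ if $i \neq 2^j$ for every $j \in \mathbb{N}\cup\{0\}$, and $p_i \cdot y = j\psi$ if $i = 2^j$; $q_i \cdot x = q_i \cdot y = \Omega$; $w \cdot x = wx'$ and $w \cdot y = wy'$ for $w \in F'$; $\Omega \cdot x = \Omega \cdot y = \Omega$. $F[T]$ is the monoid obtained from this action by the construction above; its identity is the identity of $F$. *)

(* Defs.v *)
From HB Require Import structures.
From mathcomp Require Import all_boot.

Set Implicit Arguments.
Unset Strict Implicit.
Unset Printing Implicit Defensive.

Definition freeMonoid (X : Type) : Type := seq X.

Section FreeMonoid.
Variable X : choiceType.
HB.instance Definition _ := Choice.copy (freeMonoid X) (seq X).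
HB.instance Definition _ :=
  isMonoid.Build (freeMonoid X) (@catA X) (@cat0s X) (@cats0 X).
End FreeMonoid.

Section Words.
Variables (A : Type) (M : monoidType).
Local Open Scope group_scope.

(* The element of M represented by a word w: the image of w under the unique
   homomorphism A* -> M extending phi; see [evalw_cat] and [evalw_unique]. *)
Definition evalw (phi : A -> M) (w : seq A) : M :=
  foldr (fun a m => phi a * m) 1 w.

Lemma evalw1 phi a : evalw phi [:: a] = phi a.
Proof. exact: mulg1. Qed.

Lemma evalw_cat phi u v : evalw phi (u ++ v) = evalw phi u * evalw phi v.
Proof. by elim: u => [|a u IHu] /=; rewrite ?mul1g // IHu mulgA. Qed.

Lemma evalw_unique phi (f : seq A -> M) :
    f [::] = 1 -> {morph f : u v / u ++ v >-> u * v} ->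
    (forall a, f [:: a] = phi a) ->
  f =1 evalw phi.
Proof.
by move=> f1 fM fE; elim=> [|a w IHw] //=; rewrite -cat1s fM fE IHw.
Qed.

Definition represents_generators (phi : A -> M) : Prop :=
  forall m, exists w, evalw phi w = m.

End Words.

(* Recognised by a finite (complete, deterministic) automaton. *)
Definition regular (A : finType) (L : seq A -> Prop) : Prop :=
  exists (Q : finType) (q0 : Q) (delta : Q -> A -> Q) (acc : {set Q}),
    forall w, L w <-> foldl delta q0 w \in acc.

Definition prefix_closed (A : Type) (L : seq A -> Prop) : Prop :=
  forall u v, v <> [::] -> L (u ++ v) -> L u.

Definition Markov (M : monoidType) : Prop :=
  exists (A : finType) (phi : A -> M) (L : seq A -> Prop),
    [/\ represents_generators phi,
        regular L,
        prefix_closed L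
      & forall m : M, exists! w, L w /\ evalw phi w = m].

Record raction (S : semigroupType) (T : Type) := RAction {
  ract :> T -> S -> T;
  ractM : forall t s s', ract t (s * s')%g = ract (ract t s) s'
}.

(* The carrier S \cup T; the sum makes the union disjoint. *)
Definition adjoin (S : semigroupType) (T : choiceType) (a : raction S T) : Type :=
  (S + T)%type.

Section Adjoin.
Variables (S : semigroupType) (T : choiceType) (a : raction S T).

Definition adjoin_mul (m n : adjoin a) : adjoin a :=
  match m, n with
  | inl s, inl s' => inl (s * s')%g
  | inl _, inr t => inr t
  | inr t, inl s => inr (a t s)
  | inr _, inr t => inr t
  end.

Lemma adjoin_mulA : associative adjoin_mul.
Proof. by case=> [s|t] [s'|t'] [s''|t''] //=; rewrite ?mulgA ?ractM. Qed.

HB.instance Definition _ := Choice.copy (adjoin a) (S + T)%type.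
HB.instance Definition _ := isSemigroup.Build (adjoin a) adjoin_mulA.
End Adjoin.

Inductive X := gx | gy.
Inductive X' := gx' | gy'.

Definition bool_of_X (a : X) : bool := if a is gx then false else true.
Definition X_of_bool (b : bool) : X := if b then gy else gx.
Lemma bool_of_XK : cancel bool_of_X X_of_bool. Proof. by case. Qed.
HB.instance Definition _ := Finite.copy X (can_type bool_of_XK).

Definition bool_of_X' (a : X') : bool := if a is gx' then false else true.
Definition X'_of_bool (b : bool) : X' := if b then gy' else gx'.
Lemma bool_of_X'K : cancel bool_of_X' X'_of_bool. Proof. by case. Qed.
HB.instance Definition _ := Finite.copy X' (can_type bool_of_X'K).

Definition prime_letter (a : X) : X' := if a is gx then gx' else gy'.


Definition inR (w : seq X') : bool := ~~ odd (count_mem gy' w).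

(* [le] is the (reflexive) ordering of the letters. *)
Fixpoint lexle (le : rel X') (u v : seq X') : bool :=
  match u, v with
  | [::], _ => true
  | _ :: _, [::] => false
  | a :: u', b :: v' => if a == b then lexle le u' v' else le a b
  end.

Definition shortlex (le : rel X') (u v : seq X') : bool :=
  (size u < size v) || ((size u == size v) && lexle le u v).

Definition Rlevel (le : rel X') (n : nat) : seq (seq X') :=
  sort (lexle le) [seq w <- [seq tval t | t : n.-tuple X'] | inR w].

(* The words of R of length at most j, in order: there are at least j.+1 of
   them, since R contains all powers of x'; so the j-th one is w_j.  That this
   is the intended enumeration is [psi_inR], [psi_mono] and [psi_surj]. *)
Definition psi (le : rel X') (j : nat) : seq X' :=
  nth [::] (flatten [seq Rlevel le n | n <- iota 0 j.+1]) j.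

Section Enumeration.
Variable le : rel X'.

Let Rupto n := flatten [seq Rlevel le k | k <- iota 0 n].

Lemma mem_Rlevel n w : (w \in Rlevel le n) = (size w == n) && inR w.
Proof.
rewrite mem_sort mem_filter andbC; congr andb.
apply/imageP/eqP => [[t _ ->]|sw]; first exact: size_tuple.
by exists (tcast sw (in_tuple w)); rewrite ?val_tcast.
Qed.

Lemma Rlevel_uniq n : uniq (Rlevel le n).
Proof.
rewrite sort_uniq filter_uniq // map_inj_uniq ?enum_uniq //.
exact: val_inj.
Qed.

Let RuptoS n : Rupto n.+1 = Rupto n ++ Rlevel le n.
Proof. by rewrite /Rupto -addn1 iotaD map_cat flatten_cat /= cats0. Qed.

Let mem_Rupto n w : (w \in Rupto n) = (size w < n) && inR w.
Proof.
elim: n => [|n IHn] //; rewrite RuptoS mem_cat IHn mem_Rlevel -andb_orl orbC.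
by rewrite ltnS [size w <= n]leq_eqVlt.
Qed.

Let Rupto_size n : n <= size (Rupto n).
Proof.
elim: n => // n IHn; rewrite RuptoS size_cat -addn1 leq_add //.
suff: nseq n gx' \in Rlevel le n by case: (Rlevel le n).
by rewrite mem_Rlevel size_nseq eqxx /inR count_nseq.
Qed.

Let Rupto_prefix m n : m <= n -> exists s, Rupto n = Rupto m ++ s.
Proof.
elim: n => [|n IHn]; first by rewrite leqn0 => /eqP->; exists [::]; rewrite cats0.
rewrite leq_eqVlt => /orP[/eqP->|/IHn[s Es]]; first by exists [::]; rewrite cats0.
by exists (s ++ Rlevel le n); rewrite RuptoS Es catA.
Qed.

Let psiE j n : j < size (Rupto n) -> psi le j = nth [::] (Rupto n) j.
Proof.
move=> lt_j; have := Rupto_size j.+1; rewrite /psi -/(Rupto j.+1).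
have [/Rupto_prefix[s E]|/ltnW/Rupto_prefix[s E]] := leqP j.+1 n => lt_j1.
  by rewrite E nth_cat lt_j1.
by rewrite E nth_cat lt_j.
Qed.

Lemma psi_inR j : inR (psi le j).
Proof.
have := mem_nth [::] (Rupto_size j.+1); rewrite -psiE ?Rupto_size //.
by rewrite mem_Rupto => /andP[].
Qed.

Lemma psi_surj w : inR w -> exists j, psi le j = w.
Proof.
move=> Rw; have w_in : w \in Rupto (size w).+1 by rewrite mem_Rupto ltnS leqnn.
exists (index w (Rupto (size w).+1)).
by rewrite (@psiE _ (size w).+1) ?index_mem // nth_index.
Qed.

Hypotheses (le_total : total le) (le_anti : antisymmetric le)
  (le_trans : transitive le).

Lemma lexle_total : total (lexle le).
Proof.
elim=> [|a u IHu] [|b v] //=.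
by rewrite [b == a]eq_sym; case: eqP => // _; apply: le_total.
Qed.

Lemma lexle_trans : transitive (lexle le).
Proof.
elim=> [|b v IHv] [|a u] [|c w] //=.
case: eqP => [->|ab]; first by case: eqP => // _; apply: IHv.
case: eqP => [<-|bc lab lbc]; first by case: eqP ab.
case: eqP => [ac|_]; last exact: le_trans lab lbc.
by case: ab; apply: le_anti; rewrite lab ac lbc.
Qed.

Lemma shortlex_trans : transitive (shortlex le).
Proof.
move=> v u w; rewrite /shortlex.
case/orP=> [uv|/andP[/eqP-> uv]]; case/orP=> [vw|/andP[/eqP vw vw']].
- by rewrite (ltn_trans uv vw).
- by rewrite -vw uv.
- by rewrite vw.
by rewrite vw eqxx (lexle_trans uv vw') orbT.
Qed.

Let Rupto_sorted n : pairwise (shortlex le) (Rupto n).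
Proof.
elim: n => // n IHn; rewrite RuptoS pairwise_cat IHn /=; apply/andP; split.
  apply/allrelP => u v; rewrite mem_Rupto mem_Rlevel /shortlex.
  by move=> /andP[lt_u _] /andP[/eqP-> _]; rewrite lt_u.
have: pairwise (lexle le) (Rlevel le n).
  by rewrite -(sorted_pairwise lexle_trans) sort_sorted //; apply: lexle_total.
apply: (sub_in_pairwise (P := mem (Rlevel le n))); last exact/allP.
move=> u v; rewrite !mem_Rlevel => /andP[/eqP su _] /andP[/eqP sv _] uv.
by rewrite /shortlex su sv eqxx uv orbT.
Qed.

Let Rupto_uniq n : uniq (Rupto n).
Proof.
elim: n => // n IHn; rewrite RuptoS cat_uniq IHn Rlevel_uniq andbT /=.
apply/hasPn => w; rewrite mem_Rlevel mem_Rupto => /andP[/eqP-> _].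
by rewrite ltnn.
Qed.

Lemma psi_mono i j : i < j -> shortlex le (psi le i) (psi le j) /\ psi le i <> psi le j.
Proof.
move=> ij; have sj : j < size (Rupto j.+1) := Rupto_size j.+1.
have si : i < size (Rupto j.+1) := ltn_trans ij sj.
rewrite !(@psiE _ j.+1) //; split; first exact: (pairwiseP [::] (Rupto_sorted _)).
by apply/eqP; rewrite nth_uniq // ltn_eqF.
Qed.

End Enumeration.

(* For i > 0, [trunc_log 2 i] is the only candidate exponent. *)
Definition is_pow2 (i : nat) : bool := i == 2 ^ trunc_log 2 i.

Lemma is_pow2P i : reflect (exists j, i = 2 ^ j) (is_pow2 i).
Proof.
apply: (iffP eqP) => [Ei|[j ->]]; first by exists (trunc_log 2 i).
by rewrite trunc_expnK.
Qed.

Definition Pidx := {i : nat | 0 < i}.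
Definition Qidx := {i : nat | (0 < i) && ~~ is_pow2 i}.

Inductive T := Tp of Pidx | Tq of Qidx | Tw of freeMonoid X' | TOmega.

Definition sum_of_T (t : T) : Pidx + Qidx + seq X' + unit :=
  match t with
  | Tp i => inl (inl (inl i))
  | Tq i => inl (inl (inr i))
  | Tw w => inl (inr w)
  | TOmega => inr tt
  end.
Definition T_of_sum (s : Pidx + Qidx + seq X' + unit) : T :=
  match s with
  | inl (inl (inl i)) => Tp i
  | inl (inl (inr i)) => Tq i
  | inl (inr w) => Tw w
  | inr tt => TOmega
  end.
Lemma sum_of_TK : cancel sum_of_T T_of_sum. Proof. by case. Qed.
HB.instance Definition _ := Choice.copy T (can_type sum_of_TK).

Definition PidxS (i : Pidx) : Pidx := exist _ (val i).+1 isT.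

(* [insub (val i)] is [Some] of i seen in Qidx if i is not a power of 2, and
   [None] otherwise. *)
Definition act_gen (le : rel X') (t : T) (a : X) : T :=
  match t, a with
  | Tp i, gx => Tp (PidxS i)
  | Tp i, gy =>
      if insub (val i) is Some q then Tq q else Tw (psi le (trunc_log 2 (val i)))
  | Tq _, _ => TOmega
  | Tw w, a => Tw (rcons w (prime_letter a))
  | TOmega, _ => TOmega
  end.

Lemma act_gen_py_pow2 le (i : Pidx) j :
  val i = 2 ^ j -> act_gen le (Tp i) gy = Tw (psi le j).
Proof.
move=> Ei /=; rewrite insubF ?Ei ?trunc_expnK //.
by apply/negbTE; rewrite negb_and negbK (introT (is_pow2P _)) ?orbT //; exists j.
Qed.

Lemma act_gen_py_npow2 le (i : Pidx) (q : Qidx) :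
  val i = val q -> act_gen le (Tp i) gy = Tq q.
Proof. by move=> Ei /=; rewrite Ei valK. Qed.

Definition act_word (le : rel X') (t : T) (w : freeMonoid X) : T :=
  foldl (act_gen le) t w.

Lemma act_wordM le t (u v : freeMonoid X) :
  act_word le t (u * v)%g = act_word le (act_word le t u) v.
Proof. exact: foldl_cat. Qed.

Lemma act_word_unique le (f : T -> freeMonoid X -> T) :
    (forall t, f t 1%g = t) ->
    (forall t (u v : freeMonoid X), f t (u * v)%g = f (f t u) v) ->
    (forall t a, f t [:: a] = act_gen le t a) ->
  forall t w, f t w = act_word le t w.
Proof.
move=> f1 fM fE t w; elim: w t => [|a w IHw] t; first exact: f1.
by rewrite -[a :: w]/(([:: a] : freeMonoid X) * w)%g fM fE IHw.
Qed.

Definition FT_action (le : rel X') : raction (freeMonoid X) T :=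
  RAction (act_wordM le).

Definition FT (le : rel X') : Type := adjoin (FT_action le).

Section FTMonoid.
Variable le : rel X'.

HB.instance Definition _ := Semigroup.copy (FT le) (adjoin (FT_action le)).

Let one : FT le := inl 1%g.

Lemma FT_mul1 : left_id one (@mul (FT le)).
Proof. by case. Qed.

Lemma FT_mulr1 : right_id one (@mul (FT le)).
Proof. by case=> // w; congr inl; apply: mulg1. Qed.

HB.instance Definition _ := Semigroup_isMonoid.Build (FT le) FT_mul1 FT_mulr1.
End FTMonoid.

(* Main.v *)
Require Import Defs.
From HB Require Import structures.
From mathcomp Require Import all_boot.
From mathcomp Require Import zify.

(** The words of [L] form a tree on the elements of the monoid, an edge [b] out
of [m] leading to [m * phi b], and the edges out of [m] depend only on the state
[st m] of the automaton after the word of [m].  Up to finitely many exceptions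
the parent of each [p_n] is some [p_k] at bounded distance, so by pigeonhole
[st p_n] is eventually periodic, with period [r] say.  The edge that leads to
[q_i] for [i = 2^j + r] is therefore also available [r] steps earlier, where it
leads to [w_j]; thus [w_j], [q_i] and [q_(i + r)] have the same state for large
[j].  A child of [w_j] would produce children of both [q_i] and [q_(i + r)]
representing the same element, so almost all elements of [R] are leaves.  But
the parent of [x'^H y'] is, for large [H], a long power of [x'], hence a non-leaf
in [R]. *)

Set Implicit Arguments.
Unset Strict Implicit.
Unset Printing Implicit Defensive.

(** * The tree of normal forms of a Markov monoid *)

(** Prefix-closure supplies parents, and uniqueness of the word of an element makes them unique; a
    child differs from its parent because its word is one letter longer. *)
Lemma Markov_tree (M : monoidType) : Markov M ->
  exists (A Q : finType) (phi : A -> M) (st : M -> Q) (ok : Q -> A -> bool),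
  [/\ forall m, m <> 1%g -> exists m0 b, ok (st m0) b /\ (m0 * phi b)%g = m,
      forall m m' b b', ok (st m) b -> ok (st m') b' ->
        (m * phi b = m' * phi b')%g -> m = m',
      forall m m' b, ok (st m) b -> st m = st m' ->
        st (m * phi b)%g = st (m' * phi b)%g
    & forall m b, ok (st m) b -> (m * phi b)%g <> m].
Proof.
case=> A [phi [L [_ [Q [q0 [delta [acc accP]]]] Lpre Luniq]]].
have ex m : exists w, (foldl delta q0 w \in acc) && (evalw phi w == m).
  by have [w [[/accP Lw /eqP ew] _]] := Luniq m; exists w; rewrite Lw.
pose wrd m := xchoose (ex m).
have wrdL m : L (wrd m) by have /andP[/accP] := xchooseP (ex m).
have wrdE m : evalw phi (wrd m) = m by have /andP[_ /eqP] := xchooseP (ex m).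
have wrd_eq w m : L w -> evalw phi w = m -> wrd m = w.
  move=> Lw ew; have [w' [_ w'P]] := Luniq m.
  by transitivity w'; [apply: esym|]; apply: w'P.
pose st m := foldl delta q0 (wrd m).
pose ok q b := delta q b \in acc.
have ev_rcons w b : evalw phi (rcons w b) = (evalw phi w * phi b)%g.
  by rewrite -cats1 evalw_cat evalw1.
have okE m b : ok (st m) b -> wrd (m * phi b)%g = rcons (wrd m) b.
  move=> okb; apply: wrd_eq; last by rewrite ev_rcons wrdE.
  by apply/accP; rewrite foldl_rcons.
exists A, Q, phi, st, ok; split.
- move=> m m1; have:= wrdE m; have:= wrdL m; case/lastP: (wrd m) => [_ /esym //|w b].
  move=> Lwb; rewrite ev_rcons => <-; exists (evalw phi w), b; split=> //.
  have Lw : L w by apply: Lpre (w) [:: b] _ _; rewrite ?cats1.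
  by rewrite /ok /st (wrd_eq w) // -foldl_rcons; apply/accP.
- move=> m m' b b' okb okb' E.
  have := okE _ _ okb; rewrite E okE // => /rcons_inj[Ew _].
  by rewrite -(wrdE m) -Ew wrdE.
- move=> m m' b okb Es; have okb' : ok (st m') b by rewrite -Es.
  by rewrite /st !okE // !foldl_rcons -!/(st _) Es.
- move=> m b okb E; have := okE _ _ okb.
  by rewrite E => /(congr1 size); rewrite size_rcons; lia.
Qed.

(* The index is shifted: [p n] is the paper's p_(n+1). *)
Definition p (n : nat) : T := Tp (exist _ n.+1 isT).

Lemma Tp_p (i : Pidx) : Tp i = p (val i).-1.
Proof. by congr Tp; apply: val_inj => /=; case: i => -[]. Qed.

Lemma seqX_cases (f : seq X) :
  (exists m, f = nseq m gx) \/ (exists m z, f = nseq m gx ++ gy :: z).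
Proof.
elim: f => [|[] f IHf]; first by left; exists 0.
  case: IHf => [[m ->]|[m [z ->]]]; first by left; exists m.+1.
  by right; exists m.+1, z.
by right; exists 0, f.
Qed.

Lemma Qidx_ex i : 0 < i -> ~~ is_pow2 i -> exists q : Qidx, val q = i.
Proof.
move=> i0 Ni; have Qi : (0 < i) && ~~ is_pow2 i by rewrite i0.
by exists (exist _ i Qi).
Qed.

Lemma Qidx_between j i : 2 ^ j < i < 2 ^ j.+1 -> exists q : Qidx, val q = i.
Proof.
case/andP=> lt1 lt2; apply: Qidx_ex; first exact: leq_ltn_trans lt1.
apply/is_pow2P => -[k Ei]; move: lt1 lt2; rewrite Ei !ltn_exp2l //; lia.
Qed.

(** * How words of [F] move the points of [T] *)

Section Action.
Variable le : rel X'.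
Local Notation act := (act_word le).

Lemma act_cat t u v : act t (u ++ v) = act (act t u) v.
Proof. exact: foldl_cat. Qed.

Lemma act_p_x n m : act (p n) (nseq m gx) = p (n + m).
Proof.
elim: m n => [|m IHm] n; first by rewrite addn0.
by rewrite addnS -addSn -IHm.
Qed.

Lemma act_Omega f : act TOmega f = TOmega.
Proof. by elim: f. Qed.

Lemma act_q q f : f <> [::] -> act (Tq q) f = TOmega.
Proof. by case: f => // a f _; apply: act_Omega. Qed.

Lemma act_w w f : act (Tw w) f = Tw (w ++ map prime_letter f).
Proof.
elim: f w => [|a f IHf] w; first by rewrite /= cats0.
by rewrite [LHS]IHf cat_rcons.
Qed.

Lemma act_p_y_q n m z (q : Qidx) : val q = (n + m).+1 ->
  act (p n) (nseq m gx ++ gy :: z) = act (Tq q) z.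
Proof.
move=> Eq; rewrite act_cat act_p_x /=.
by rewrite insubT -?Eq ?(valP q) // => ?; congr foldl; congr Tq; apply: val_inj.
Qed.

Lemma act_p_y_w n m z j : 2 ^ j = (n + m).+1 ->
  act (p n) (nseq m gx ++ gy :: z) = Tw (psi le j ++ map prime_letter z).
Proof.
move=> Ej; rewrite act_cat act_p_x -act_w.
rewrite -[LHS]/(act (act_gen le (p (n + m)) gy) z).
by rewrite (@act_gen_py_pow2 _ _ j).
Qed.

Lemma pow2_or_Qidx n m :
  (exists j, 2 ^ j = (n + m).+1) \/ (exists q : Qidx, val q = (n + m).+1).
Proof.
case: (boolP (is_pow2 (n + m).+1)) => [/is_pow2P[j Ej]|Nn]; first by left; exists j.
by right; apply: Qidx_ex.
Qed.

(** Nothing outside [P] flows into [P], and a letter [gy] leaves [P] for good. *)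
Lemma act_p_inv t f n : act t f = p n ->
  exists k m, [/\ t = p k, f = nseq m gx & n = k + m].
Proof.
case: t => [i|q|w|].
- rewrite Tp_p; move: (val i).-1 => k.
  have [[m ->]|[m [z ->]]] := seqX_cases f.
    by rewrite act_p_x => -[<-]; exists k, m.
  have [[j Ej]|[q Eq]] := pow2_or_Qidx k m; first by rewrite (act_p_y_w _ Ej).
  by rewrite (act_p_y_q _ Eq); case: z => // a z; rewrite act_q.
- by case: f => // a f; rewrite act_q.
- by rewrite act_w.
- by rewrite act_Omega.
Qed.

Lemma act_q_inv t f q : act t f = Tq q -> f <> [::] ->
  exists k m, [/\ t = p k, f = nseq m gx ++ [:: gy] & val q = (k + m).+1].
Proof.
case: t => [i|q'|w|].
- rewrite Tp_p; move: (val i).-1 => k.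
  have [[m ->]|[m [z ->]]] := seqX_cases f; first by rewrite act_p_x.
  have [[j Ej]|[q' Eq]] := pow2_or_Qidx k m; first by rewrite (act_p_y_w _ Ej).
  rewrite (act_p_y_q _ Eq); case: z => [|a z]; last by rewrite act_q.
  by case=> <- _; exists k, m.
- by move=> + f0; rewrite act_q.
- by rewrite act_w.
- by rewrite act_Omega.
Qed.

Lemma act_w_inv t f w : act t f = Tw w ->
  (exists2 w0, t = Tw w0 & w = w0 ++ map prime_letter f) \/
  exists k m z j, [/\ t = p k, f = nseq m gx ++ gy :: z, 2 ^ j = (k + m).+1
                    & w = psi le j ++ map prime_letter z].
Proof.
case: t => [i|q'|w0|].
- rewrite Tp_p; move: (val i).-1 => k.
  have [[m ->]|[m [z ->]]] := seqX_cases f; first by rewrite act_p_x.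
  have [[j Ej]|[q' Eq]] := pow2_or_Qidx k m.
    by rewrite (act_p_y_w _ Ej) => -[<-]; right; exists k, m, z, j.
  by rewrite (act_p_y_q _ Eq); case: z => [|a z] //; rewrite act_q.
- by case: f => // a f; rewrite act_q.
- by rewrite act_w => -[<-]; left; exists w0.
- by rewrite act_Omega.
Qed.

End Action.

(** * Periodicity along [P] and the contradiction *)

Lemma mul_act le t (f : freeMonoid X) :
  ((inr t : FT le) * (inl f : FT le))%g = inr (act_word le t f).
Proof. by []. Qed.

Definition weight le (m : FT le) : nat :=
  match m with
  | inl f => size f
  | inr (Tp i) => val i
  | inr (Tq i) => val i
  | inr (Tw w) => size w
  | inr TOmega => 0
  end.

Section Tree.
Variables (le : rel X') (A Q : finType) (phi : A -> FT le).
Variables (st : FT le -> Q) (ok : Q -> A -> bool).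
Hypothesis parent_ex :
  forall m, m <> 1%g -> exists m0 b, ok (st m0) b /\ (m0 * phi b)%g = m.
Hypothesis parent_inj : forall m m' b b', ok (st m) b -> ok (st m') b' ->
  (m * phi b = m' * phi b')%g -> m = m'.
Hypothesis st_child : forall m m' b, ok (st m) b -> st m = st m' ->
  st (m * phi b)%g = st (m' * phi b)%g.
Hypothesis child_neq : forall m b, ok (st m) b -> (m * phi b)%g <> m.

Local Notation act := (act_word le).
Local Notation inT t := (inr t : FT le).

Let B := \max_b weight (phi b).

Let weight_le b : weight (phi b) <= B.
Proof. exact: leq_bigmax. Qed.

(** Right multiplication by an element of [T] yields that element, so edges labelled in [T] reach
    only weights at most [B]; any other edge into [T] starts in [T] and is labelled by a short
    word. *)
Lemma parentT t : B < weight (inT t) ->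
  exists t0 b f, [/\ ok (st (inT t0)) b, phi b = inl f, f <> [::], size f <= B
                   & act t0 f = t].
Proof.
move=> tB; have [//|m0 [b [okb]]] := @parent_ex (inT t).
have := weight_le b; have := child_neq okb.
case Eb: (phi b) => [f|t'].
  case: m0 okb => [g|t0] // okb neq fB [Et]; exists t0, b, f; split=> //.
  by move=> f0; apply: neq; rewrite f0.
move=> _ Bt' Et; have {}Et : t' = t by case: m0 okb Et => [g|t0] _ [].
by move: tB; rewrite -Et ltnNge Bt'.
Qed.

Lemma st_p_periodic :
  exists N r, 0 < r /\ forall n, N <= n -> st (inT (p (n + r))) = st (inT (p n)).
Proof.
(* The parent of [p n] lies at most [B] steps back, so a window of [B.+1] states determines all
   later ones. *)
pose win n := [ffun k : 'I_B.+1 => st (inT (p (B + n + k)))].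
pose W (i : 'I_#|{ffun 'I_B.+1 -> Q}|.+1) := win i.
have /injectivePn[i0 [j0 ij0 Wij0]] : ~~ injectiveb W.
  by apply/injectiveP => /leq_card; rewrite card_ord ltnn.
have [i [j [ij Wij]]] : exists i j, i < j /\ win i = win j.
  case: (ltngtP i0 j0) => [lt|lt|/val_inj E]; last by rewrite E eqxx in ij0.
    by exists i0, j0.
  by exists j0, i0.
exists (B + i), (j - i); split; first lia.
elim/ltn_ind => n IHn leNn.
have [nB|Bn] := leqP n (B + i + B).
  have kB : n - (B + i) < B.+1 by lia.
  have := congr1 (fun g : {ffun 'I_B.+1 -> Q} => g (Ordinal kB)) Wij; rewrite !ffunE /=.
  have -> : B + i + (n - (B + i)) = n by lia.
  by have -> : B + j + (n - (B + i)) = n + (j - i) by lia.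
have [|t0 [b [f [okb Eb f0 fB /act_p_inv[k [m [Et Ef En]]]]]]] := @parentT (p n).
  by rewrite /weight /=; lia.
move: okb f0 fB; rewrite Et Ef size_nseq => okb f0 mB.
have m0 : 0 < m by case: m f0 {Ef En mB}.
have := st_child okb (esym (IHn k _ _)).
rewrite Eb Ef !mul_act !act_p_x -En => ->; try lia.
by congr (st (inT (p _))); lia.
Qed.

(** The second clause says that an edge from [P] entering [F'] at such a [w_j] must stop there, so
    that it ends in [R]. *)
Lemma leaves : exists J, forall j, J <= j ->
  (forall b, ~~ ok (st (inT (Tw (psi le j)))) b) /\
  (forall k m z b, ok (st (inT (p k))) b -> phi b = inl (nseq m gx ++ gy :: z) ->
     2 ^ j = (k + m).+1 -> z = [::]).
Proof.
have [N [r [r0 per]]] := st_p_periodic.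
have per2 n : N <= n -> st (inT (p (n + r.*2))) = st (inT (p n)).
  by move=> Nn; rewrite -addnn addnA !per //; lia.
(* As [j < 2 ^ j], adding [r] or [r.*2] to [2 ^ j] stays below the next power of 2, and the parents
   used below keep index at least [N] after a shift back by [r]. *)
exists (N + B + r.*2).+1 => j Jj.
have j2 : j < 2 ^ j by apply: ltn_expl.
have [q1 Eq1] : exists q : Qidx, val q = 2 ^ j + r.
  by apply: (@Qidx_between j); rewrite expnS; lia.
have [q2 Eq2] : exists q : Qidx, val q = 2 ^ j + r.*2.
  by apply: (@Qidx_between j); rewrite expnS; lia.
have q12 : q1 <> q2 by move=> E; move: Eq2; rewrite -E Eq1; lia.
split.
  have [|t0 [b [f [okb Eb f0 fB /act_q_inv[//|k [m [Et Ef Ek]]]]]]] := @parentT (Tq q1).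
    by rewrite /weight Eq1; lia.
  move: okb fB; rewrite Et Ef size_cat size_nseq addn1 => okb mB.
  (* The same edge [b] leads from [p k'] to [w_j], from [p (k' + r)] to [q1] and from
     [p (k' + r.*2)] to [q2]. *)
  have [k' Ek'] : exists k', k = k' + r by exists (k - r); lia.
  have Nk' : N <= k' by lia.
  move: okb; rewrite Ek' => okb.
  have st1 : st (inT (Tq q1)) = st (inT (Tw (psi le j))).
    have := st_child okb (per k' Nk'); rewrite Eb Ef.
    rewrite !mul_act (@act_p_y_q _ _ _ _ q1) -?Ek' //= => ->.
    rewrite (@act_p_y_w _ _ _ _ j) ?cats0 //; lia.
  have st2 : st (inT (Tq q1)) = st (inT (Tq q2)).
    have := st_child okb (etrans (per k' Nk') (esym (per2 k' Nk'))); rewrite Eb Ef.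
    rewrite !mul_act (@act_p_y_q _ _ _ _ q1) -?Ek' //= => ->.
    rewrite (@act_p_y_q _ _ _ _ q2) //; lia.
  move=> c; apply/negP; rewrite -st1 => okc; have okc2 := okc; rewrite st2 in okc2.
  suff E : (inT (Tq q1) * phi c = inT (Tq q2) * phi c)%g.
    by have [] := parent_inj okc okc2 E.
  (* The empty word is excluded by [child_neq]; a nonempty one sends both to [TOmega], and an
     element of [T] absorbs both. *)
  by have := child_neq okc; case: (phi c) => [[|a g]|t].
move=> k m z b okb Eb Ekm; have := weight_le b.
rewrite Eb /weight size_cat size_nseq /= => mB.
case: z Eb mB => // a z Eb mB; have Nk : N <= k by lia.
have ok1 := okb; rewrite -(per k Nk) in ok1.
have ok2 := okb; rewrite -(per2 k Nk) in ok2.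
(* Shifted, the edge passes through [q1] or [q2], and its nonempty tail [a :: z] then leads to
   [TOmega]. *)
suff E : (inT (p (k + r)) * phi b)%g = (inT (p (k + r.*2)) * phi b)%g.
  by have [] := parent_inj ok1 ok2 E; lia.
rewrite Eb !mul_act.
by rewrite (@act_p_y_q _ _ _ _ q1) ?(@act_p_y_q _ _ _ _ q2) ?act_q //; lia.
Qed.

Lemma no_tree : False.
Proof.
have [J JP] := leaves.
pose S := \max_(j < J) size (psi le j).
have SP j : j < J -> size (psi le j) <= S.
  by move=> jJ; apply: (leq_bigmax (Ordinal jJ)).
(* Removing up to [B] last letters leaves a word longer than every [w_j] with [j < J]; the single
   [gy'] keeps [w] outside [R]. *)
pose w := nseq (S + B.*2).+1 gx' ++ [:: gy'].
have sw : size w = (S + B.*2).+2 by rewrite size_cat size_nseq addn1.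
have Rw : ~~ inR w by rewrite /inR count_cat count_nseq.
have [|t0 [b [f [okb Eb f0 fB /act_w_inv]]]] := @parentT (Tw w).
  by rewrite /weight sw; lia.
case=> [[w0 Et Ew]|[k [m [z [j [Et Ef Ej Ew]]]]]].
  have sf : 0 < size f by case: f f0 {Eb fB Ew}.
  have sw0 : size w0 + size f = (S + B.*2).+2 by rewrite -sw Ew size_cat size_map.
  (* The nonempty label [f] accounts for the final [gy']. *)
  have Ew0 : w0 = nseq (size w0) gx'.
    have := take_size_cat (map prime_letter f) (erefl (size w0)).
    by rewrite -Ew takel_cat ?take_nseq ?size_nseq //; lia.
  have [j Ej] : exists j, psi le j = w0.
    by apply: psi_surj; rewrite /inR Ew0 count_nseq.
  have [jJ|/JP[/(_ b)]] := ltnP j J; last by rewrite Ej -Et okb.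
  by have := SP j jJ; rewrite Ej; lia.
have [jJ|/JP[_ /(_ k m z b)]] := ltnP j J.
  have := SP j jJ; have := congr1 size Ew; move: fB.
  by rewrite Ef sw !size_cat size_nseq size_map /=; lia.
rewrite -Et okb Eb Ef => /(_ isT erefl Ej) z0.
by move: Rw; rewrite Ew z0 cats0 psi_inR.
Qed.

End Tree.

Theorem proposition6p3 (le : rel X') (le_total : total le)
  (le_anti : antisymmetric le) (le_trans : transitive le) :
  ~ Markov (FT le).
Proof.
move=> /Markov_tree[A [Q [phi [st [ok [ex inj child neq]]]]]].
exact: no_tree ex inj child neq.
Qed.
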